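(* Let $P=(X_p,X_{p,0},U_p,\mathcal U_p,f_p)$ be a (plant) control system and $Q=(X_q,X_{q,0},U_q,\mathcal U_q,f_q)$ a (specification) autonomous system, and let $\varepsilon\in\mathbb R^+$ be a precision. Suppose $P$ and $Q$ are $\delta$-ISS, with $\mathcal{KL}$ function $\beta_p$ and $\mathcal K_\infty$ function $\gamma_p$ for $P$ and $\mathcal{KL}$ function $\beta_q$ for $Q$. Choose $\theta_p,\theta_q\in\mathbb R^+$ so that $\theta_p+\theta_q\le\varepsilon$, and choose $\tau,\eta,\mu\in\mathbb R^+$ satisfying $$\beta_p(\theta_p,\tau)+\gamma_p(\mu)+\eta\le\theta_p,\qquad \beta_q(\theta_q,\tau)+\eta\le\theta_q .$$ Put $S_p=S_{\tau,\eta,\mu}(P)$, $S_q=S_{\tau,\eta,0}(Q)$ and $C^\ast=S_p\parallel_0 S_q$. Then, with $\theta=\theta_p$, $Nb(C^\ast)$ is a symbolic controller in the class $\mathcal C^{\tau,\theta,\mu}(P)$ and it solves the symbolic control design problem for $P$, $Q$, $\varepsilon$, that is: (i) $\bigl(S_\tau(P)\parallel_{\theta}Nb(C^\ast)\bigr)\preceq_\varepsilon S_\tau(Q)$; (ii) $S_\tau(P)\parallel_{\theta}Nb(C^\ast)$ is non-blocking.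
   Context: $\|\cdot\|$ is the infinity norm on $\mathbb R^n$; for a function $u$, $\|u\|_\infty$ is its essential supremum. $\mathbb R^+$ denotes the positive reals and $\mathbb R_0^+$ the nonnegative reals. Control systems. A control system is $\Sigma=(X,X_0,U,\mathcal U,f)$ with state space $X\subseteq\mathbb R^n$, initial states $X_0\subseteq X$, input space $U\subseteq\mathbb R^m$, $\mathcal U$ a subset of the set of all locally essentially bounded functions from intervals $]a,b[$ ($a<0<b$) to $U$, and $f:\mathbb R^n\times U\to\mathbb R^n$ continuous and such that for each compact $K\subset\mathbb R^n$ there is $\kappa\in\mathbb R^+$ with $\|f(x,u)-f(y,u)\|\le\kappa\|x-y\|$ for all $x,y\in K$, $u\in U$. A trajectory is a curve $\xi:]a,b[\to\mathbb R^n$ with $\dot\xi(t)=f(\xi(t),u(t))$ for almost all $t$, for some $u\in\mathcal U$; trajectories on $[0,\tau]$ are restrictions of trajectories on open intervals. $\xi_{xu}(\tau)$ is the point reached at time $\tau$ from $x$ under $u$. $\Sigma$ is forward complete if every trajectory is defined on an interval $]a,\infty[$. An autonomous system $\dot x=g_q(x)$ is viewed as a control system with $U_q=\{0\}$, $\mathcal U_q=\{\mathbf 0\}$ (the identically null signal), $f_q(x,u)=g_q(x)+u$. $\delta$-ISS. $\gamma:\mathbb R_0^+\to\mathbb R_0^+$ is $\mathcal K_\infty$ if it is continuous, strictly increasing, $\gamma(0)=0$ and $\gamma(r)\to\infty$ as $r\to\infty$; a continuous $\beta:\mathbb R_0^+\times\mathbb R_0^+\to\mathbb R_0^+$ is $\mathcal{KL}$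 if $\beta(\cdot,s)$ is $\mathcal K_\infty$ for each $s$ and, for each $r$, $\beta(r,\cdot)$ is decreasing with $\beta(r,s)\to0$ as $s\to\infty$. $\Sigma$ is $\delta$-ISS (incrementally input-to-state stable) if it is forward complete and there are $\beta\in\mathcal{KL}$, $\gamma\in\mathcal K_\infty$ with $\|\xi_{xu}(t)-\xi_{x'u'}(t)\|\le\beta(\|x-x'\|,t)+\gamma(\|u-u'\|_\infty)$ for all $t\in\mathbb R_0^+$, $x,x'\in\mathbb R^n$, $u,u'\in\mathcal U$ (for an autonomous system the $\gamma$ term vanishes). Systems. A system is $S=(X,X_0,U,\to,Y,H)$ with states $X$, initial states $X_0\subseteq X$, inputs $U$, transition relation $\to\subseteq X\times U\times X$ (written $x\xrightarrow{u}x'$), output set $Y$, output map $H:X\to Y$. It is metric if $Y$ carries a metric $d$, and non-blocking if every state has at least one outgoing transition. $S_1$ is a sub-system of $S_2$ ($S_1\sqsubseteq S_2$) if $X_1\subseteq X_2$, $X_{0,1}\subseteq X_{0,2}$, $U_1\subseteq U_2$, $\to_1\subseteq\to_2$, $Y_1\subseteq Y_2$ and $H_1=H_2$ on $X_1$. $Nb(S)$ (the non-blocking part of $S$) is the non-blocking sub-system of $S$ such that $S'\sqsubseteq Nb(S)$ for every non-blocking $S'\sqsubseteq S$. Simulation. For metric systems with the same output set and metric $d$, and $\varepsilon\in\mathbb R_0^+$, $\mathcal R\subseteq X_1\times X_2$ is an $\varepsilon$-approximate simulation relation from $S_1$ to $S_2$ if: each $x_1\in X_{0,1}$ has some $x_2\in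 X_{0,2}$ with $(x_1,x_2)\in\mathcal R$; $d(H_1(x_1),H_2(x_2))\le\varepsilon$ for all $(x_1,x_2)\in\mathcal R$; and for $(x_1,x_2)\in\mathcal R$, any $x_1\xrightarrow{u_1}x_1'$ in $S_1$ implies the existence of some $x_2\xrightarrow{u_2}x_2'$ in $S_2$ with $(x_1',x_2')\in\mathcal R$. $S_1\preceq_\varepsilon S_2$ means such a relation exists. Composition. For metric systems with the same output set and metric $d$, $S_1\parallel_\varepsilon S_2$ has states $X=\{(x_1,x_2)\in X_1\times X_2: d(H_1(x_1),H_2(x_2))\le\varepsilon\}$, initial states $X\cap(X_{0,1}\times X_{0,2})$, inputs $U_1\times U_2$, transitions $(x_1,x_2)\xrightarrow{(u_1,u_2)}(x_1',x_2')$ (between states in $X$) if $x_1\xrightarrow{u_1}x_1'$ and $x_2\xrightarrow{u_2}x_2'$, output set $Y_1$ and output map $(x_1,x_2)\mapsto H_1(x_1)$. Time discretization. $S_\tau(\Sigma)=(X,X_0,\mathcal U_\tau,\to_\tau,Y,H)$: $\mathcal U_\tau$ is the set of $u\in\mathcal U$ with domain $[0,\tau]$; $x\xrightarrow{u}x'$ if there is a trajectory $\xi:[0,\tau]\to X$ of $\Sigma$ with $\xi_{xu}(\tau)=x'$; $Y=X$; $H$ is the identity. Lattices and symbolic systems. $[A]_\mu=\{a\in A: a_i=k_i\mu,\ k_i\in\mathbb Z\}$; $\mathcal B_{[\eta[}(y)=\prod_i[y_i-\eta,y_i+\eta[$. $S_{\tau,\eta,\mu}(\Sigma)$ has states $[X]_{2\eta}$,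 initial states $[X]_{2\eta}\cap X_0$, inputs $[U]_{2\mu}$ (each identified with a constant input on $[0,\tau]$), transitions $x\xrightarrow{u}y$ if $\xi_{xu}(\tau)\in\mathcal B_{[\eta[}(y)\cap X$, output set $X$ and the natural inclusion as output map. For $Q$, $\mu=0$ means the input set is $\{0\}$. Symbolic controllers. For a control system $\Sigma$, sampling time $\tau\in\mathbb R^+$, state quantization $\theta\in\mathbb R^+$ and input quantization $\mu\in\mathbb R^+$, a symbolic controller for $\Sigma$ is a system $C=(X_c,X_{c,0},U_c,\to_c,Y_c,H_c)$ with $X_c=[X]_{2\theta}$, $X_{c,0}\subseteq X_c$, $U_c=\{u\in\mathcal U_\tau:\text{the co-domain of }u\text{ is }[U]_{2\mu}\}$, $\to_c\subseteq X_c\times U_c\times X_c$, $Y_c=X_c$ and $H_c$ the identity. $\mathcal C^{\tau,\theta,\mu}(\Sigma)$ is the class of all such symbolic controllers. Symbolic control design problem. Given $P$, $Q$ and $\varepsilon\in\mathbb R^+$, find $\tau,\theta,\mu\in\mathbb R^+$ and a symbolic controller $C\in\mathcal C^{\tau,\theta,\mu}(P)$ such that $(S_\tau(P)\parallel_\theta C)\preceq_\varepsilon S_\tau(Q)$ and $S_\tau(P)\parallel_\theta C$ is non-blocking. Outputs of all these systems are compared through the metric $d(p,q)=\|p-q\|$.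
   Formalization: Assumes trajectories of P and Q starting in X_p, X_q stay there ((ii) can fail otherwise); Nb(C* ) is shown to lie in the class with state quantization η, not θ_p, after identifying (x,x) with x and (u,0) with u and adding unused lattice points as isolated states; θ_p stays the composition precision. *)

(* Defs.v *)
From HB Require Import structures.
From mathcomp Require Import all_boot all_order all_algebra.
From mathcomp Require Import all_classical all_reals all_analysis.
From mathcomp Require Import measurable_realfun ess_sup_inf.

Set Implicit Arguments.
Unset Strict Implicit.
Unset Printing Implicit Defensive.

Import Order.TTheory GRing.Theory Num.Theory.
Import numFieldNormedType.Exports.

Local Open Scope classical_set_scope.
Local Open Scope ring_scope.

(* R^n is 'rV[R]_n, whose library norm `|x| is the infinity norm. *)

(* Comparison functions are total; only their values at nonnegative arguments
   are meaningful. *)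

Definition class_Kinf (R : realType) (g : R -> R) : Prop :=
  [/\ {within `[0, +oo[, continuous g},
      forall x y : R, 0 <= x -> x < y -> g x < g y,
      g 0 = 0 &
      g r @[r --> +oo] --> +oo].

Definition class_KL (R : realType) (b : R -> R -> R) : Prop :=
  [/\ {within [set p : R * R | 0 <= p.1 /\ 0 <= p.2],
         continuous (fun p : R * R => b p.1 p.2)},
      forall s : R, 0 <= s -> class_Kinf (b ^~ s) &
      forall r : R, 0 <= r ->
        (forall s t : R, 0 <= s -> s <= t -> b r t <= b r s) /\
        b r s @[s --> +oo] --> 0].

(* A function from ]slo, shi[ to R^m; the values of sigval outside this
   interval are junk. *)
Record signal (R : realType) (m : nat) := Signal {
  slo : \bar R;
  shi : \bar R;
  sigval : R -> 'rV[R]_m }.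

Definition oitv (R : realType) (a b : \bar R) : set R :=
  [set t | (a < t%:E)%E /\ (t%:E < b)%E].

Definition sdom (R : realType) (m : nat) (u : signal R m) : set R :=
  oitv (slo u) (shi u).

(* Measurability is with respect to the Lebesgue (completed Borel)
   sigma-algebra. *)
Definition locally_ess_bounded (R : realType) (m : nat) (u : signal R m) :
    Prop :=
  (forall (i : 'I_m) (B : set R), measurable B ->
     completed_algebra_gen (@lebesgue_measure R)
       (sdom u `&` [set t | B (sigval u t ord0 i)])) /\
  (forall c d : R, `[c, d] `<=` sdom u ->
     exists M : R, {ae (@lebesgue_measure R),
       forall t : R, c <= t <= d -> `|sigval u t| <= M}).

Record control_system (R : realType) (n m : nat) := ControlSystem {
  cs_X : set 'rV[R]_n;
  cs_X0 : set 'rV[R]_n;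
  cs_U : set 'rV[R]_m;
  cs_inputs : set (signal R m);
  cs_f : 'rV[R]_n -> 'rV[R]_m -> 'rV[R]_n;
  cs_X0_sub : cs_X0 `<=` cs_X;
  cs_inputsP : forall u, cs_inputs u ->
    [/\ (slo u < 0)%E, (0 < shi u)%E, locally_ess_bounded u &
        forall t, sdom u t -> cs_U (sigval u t)];
  cs_f_cont : {within [set p : 'rV[R]_n * 'rV[R]_m | cs_U p.2],
    continuous (fun p : 'rV[R]_n * 'rV[R]_m => cs_f p.1 p.2)};
  cs_f_lip : forall K : set 'rV[R]_n, compact K ->
    exists2 k : R, 0 < k &
      forall x y u, K x -> K y -> cs_U u ->
        `|cs_f x u - cs_f y u| <= k * `|x - y| }.

Definition loc_abs_continuous (R : realType) (n : nat) (a b : \bar R)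
    (xi : R -> 'rV[R]_n) : Prop :=
  forall c d : R, `[c, d] `<=` oitv a b ->
  forall e : R, 0 < e -> exists2 del : R, 0 < del &
    forall (k : nat) (s t : 'I_k -> R),
      (forall i, [/\ c <= s i, s i <= t i & t i <= d]) ->
      (forall i j, i != j -> t i <= s j \/ t j <= s i) ->
      \sum_(i < k) (t i - s i) < del ->
      \sum_(i < k) `|xi (t i) - xi (s i)| < e.

(* xi is a trajectory on ]a, b[ driven by the input u.  Solutions are in the
   sense of Caratheodory: without local absolute continuity the almost
   everywhere equation would not determine xi. *)
Definition trajectory (R : realType) (n m : nat) (S : control_system R n m)
    (u : signal R m) (a b : \bar R) (xi : R -> 'rV[R]_n) : Prop :=
  [/\ cs_inputs S u,
      [/\ (a < 0)%E, (0 < b)%E & oitv a b `<=` sdom u],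
      loc_abs_continuous a b xi &
      {ae (@lebesgue_measure R), forall t, oitv a b t ->
         is_derive t 1 xi (cs_f S (xi t) (sigval u t))}].

(* Every trajectory extends to an interval ]a, +oo[.  The input v driving the
   extension extends u (v can be u itself only if shi u = +oo). *)
Definition forward_complete (R : realType) (n m : nat)
    (S : control_system R n m) : Prop :=
  forall u a b xi, trajectory S u a b xi ->
    exists v xi', [/\ trajectory S v a +oo%E xi',
      forall t, sdom u t -> sdom v t /\ sigval v t = sigval u t &
      forall t, oitv a b t -> xi' t = xi t].

(* xi_{xu} exists for every x in R^n and every admissible u.  This is
   presupposed by the estimate of delta-ISS; it does not follow from the
   conditions on f, which may be unbounded on bounded subsets of U. *)
Definition has_trajectories (R : realType) (n m : nat)
    (S : control_system R n m) : Prop :=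
  forall (x : 'rV[R]_n) u, cs_inputs S u ->
    exists a b xi, trajectory S u a b xi /\ xi 0 = x.

(* The essential supremum of u - v, over the common domain of u and v. *)
Definition input_dist (R : realType) (m : nat) (u v : signal R m) : \bar R :=
  ess_sup (@lebesgue_measure R)
    (EFin \o patch (fun=> 0) (sdom u `&` sdom v)
                   (fun t => `|sigval u t - sigval v t|)).

(* No bound is claimed when u - v is not essentially bounded. *)
Definition delta_ISS_estimate (R : realType) (n m : nat)
    (S : control_system R n m) (beta : R -> R -> R) (gamma : R -> R) : Prop :=
  forall u a b xi u' a' b' xi' (r t : R),
    trajectory S u a b xi -> trajectory S u' a' b' xi' ->
    input_dist u u' = r%:E ->
    0 <= t -> (t%:E < b)%E -> (t%:E < b')%E ->
    `|xi t - xi' t| <= beta `|xi 0 - xi' 0| t + gamma r.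

Definition delta_ISS_with (R : realType) (n m : nat)
    (S : control_system R n m) (beta : R -> R -> R) (gamma : R -> R) : Prop :=
  [/\ forward_complete S, has_trajectories S, class_KL beta, class_Kinf gamma &
      delta_ISS_estimate S beta gamma].

Definition delta_ISS_autonomous_with (R : realType) (n m : nat)
    (S : control_system R n m) (beta : R -> R -> R) : Prop :=
  [/\ forward_complete S, has_trajectories S, class_KL beta &
      delta_ISS_estimate S beta (fun=> 0)].

Definition null_signal (R : realType) (m : nat) : signal R m :=
  Signal -oo%E +oo%E (fun=> 0).

Definition autonomous (R : realType) (n : nat) (S : control_system R n n) :
    Prop :=
  exists g : 'rV[R]_n -> 'rV[R]_n,
    [/\ cs_U S = [set 0], cs_inputs S = [set null_signal R n] &
        forall x u, cs_f S x u = g x + u].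

(* time_disc below only keeps the trajectories that remain in X; without this
   condition, trajectories that start close to one of them may leave X. *)
Definition state_space_invariant (R : realType) (n m : nat)
    (S : control_system R n m) : Prop :=
  forall u a b xi, trajectory S u a b xi -> cs_X S (xi 0) ->
    forall t : R, 0 <= t -> (t%:E < b)%E -> cs_X S (xi t).

Record system (TX TU TY : Type) := System {
  st : set TX;
  st0 : set TX;
  inp : set TU;
  trans : TX -> TU -> TX -> Prop;
  outs : set TY;
  out : TX -> TY;
  st0_sub : st0 `<=` st;
  transP : forall x u y, trans x u y -> [/\ st x, inp u & st y];
  outP : forall x, st x -> outs (out x) }.

Definition nonblocking (TX TU TY : Type) (S : system TX TU TY) : Prop :=
  forall x, st S x -> exists u y, trans S x u y.

Definition sub_system (TX TU TY : Type) (S1 S2 : system TX TU TY) : Prop :=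
  [/\ st S1 `<=` st S2, st0 S1 `<=` st0 S2, inp S1 `<=` inp S2,
      forall x u y, trans S1 x u y -> trans S2 x u y &
      outs S1 `<=` outs S2 /\ forall x, st S1 x -> out S1 x = out S2 x].

Definition is_nonblocking_part (TX TU TY : Type) (S N : system TX TU TY) :
    Prop :=
  [/\ sub_system N S, nonblocking N &
      forall S', sub_system S' S -> nonblocking S' -> sub_system S' N].

Lemma nonblocking_part_exists (TX TU TY : Type) (S : system TX TU TY) :
  exists N, is_nonblocking_part S N.
Proof.
pose sub S' := sub_system S' S /\ nonblocking S'.
pose stN := [set x | exists2 S', sub S' & st S' x].
pose st0N := [set x | exists2 S', sub S' & st0 S' x].
pose trN x u y := exists2 S', sub S' & trans S' x u y.
have h0 : st0N `<=` stN.
  by move=> x [S' hS' hx]; exists S' => //; exact: (@st0_sub _ _ _ S').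
have ht x u y : trN x u y -> [/\ stN x, inp S u & stN y].
  move=> [S' hS' h]; have [hx hu hy] := transP h.
  have [[_ _ hi _ _] _] := hS'.
  by split; [exists S'|exact: hi|exists S'].
have ho x : stN x -> outs S (out S x).
  by move=> [S' [[hs _ _ _ _] _] hx]; apply: outP; exact: hs.
exists (System h0 ht ho); split.
- split => //=; last by split.
  + by move=> x [S' [[hs _ _ _ _] _] hx]; exact: hs.
  + by move=> x [S' [[_ hs _ _ _] _] hx]; exact: hs.
  + by move=> x u y [S' [[_ _ _ hs _] _] h]; exact: hs.
- move=> x [S' hS' hx]; have [u [y h]] := hS'.2 x hx.
  by exists u, y; exists S'.
- move=> S' hS' hn; have [h1 h2 h3 h4 [h5 h6]] := hS'.
  split => //=.
  + by move=> x hx; exists S'.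
  + by move=> x hx; exists S'.
  + by move=> x u y h; exists S'.
Qed.

Definition Nb (TX TU TY : Type) (S : system TX TU TY) : system TX TU TY :=
  sval (cid (nonblocking_part_exists S)).

Lemma NbP (TX TU TY : Type) (S : system TX TU TY) :
  is_nonblocking_part S (Nb S).
Proof. exact: svalP (cid (nonblocking_part_exists S)). Qed.

(* Output sets may differ: outputs are compared with the metric of the ambient
   normed space. *)
Definition approx_sim_rel (R : realType) (Y : normedModType R)
    (TX1 TU1 TX2 TU2 : Type) (S1 : system TX1 TU1 Y) (S2 : system TX2 TU2 Y)
    (eps : R) (rel : TX1 -> TX2 -> Prop) : Prop :=
  [/\ forall x1 x2, rel x1 x2 -> st S1 x1 /\ st S2 x2,
      forall x1, st0 S1 x1 -> exists2 x2, st0 S2 x2 & rel x1 x2,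
      forall x1 x2, rel x1 x2 -> `|out S1 x1 - out S2 x2| <= eps &
      forall x1 x2, rel x1 x2 -> forall u1 y1, trans S1 x1 u1 y1 ->
        exists u2 y2, trans S2 x2 u2 y2 /\ rel y1 y2].

Definition approx_simulated (R : realType) (Y : normedModType R)
    (TX1 TU1 TX2 TU2 : Type) (eps : R) (S1 : system TX1 TU1 Y)
    (S2 : system TX2 TU2 Y) : Prop :=
  exists rel, approx_sim_rel S1 S2 eps rel.

Section Composition.
Variables (R : realType) (Y : normedModType R) (TX1 TU1 TX2 TU2 : Type).
Variables (eps : R) (S1 : system TX1 TU1 Y) (S2 : system TX2 TU2 Y).

Let cst_ : set (TX1 * TX2) :=
  [set x | [/\ st S1 x.1, st S2 x.2 & `|out S1 x.1 - out S2 x.2| <= eps]].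
Let cst0 : set (TX1 * TX2) :=
  [set x | [/\ cst_ x, st0 S1 x.1 & st0 S2 x.2]].
Let cinp : set (TU1 * TU2) := [set u | inp S1 u.1 /\ inp S2 u.2].
Let ctrans (x : TX1 * TX2) (u : TU1 * TU2) (y : TX1 * TX2) : Prop :=
  [/\ cst_ x, cst_ y, trans S1 x.1 u.1 y.1 & trans S2 x.2 u.2 y.2].
Let cout (x : TX1 * TX2) : Y := out S1 x.1.

Let cst0_sub : cst0 `<=` cst_. Proof. by move=> x []. Qed.

Let ctransP x u y : ctrans x u y -> [/\ cst_ x, cinp u & cst_ y].
Proof.
move=> [hx hy h1 h2]; split => //; split.
- by have [] := transP h1.
- by have [] := transP h2.
Qed.

Let coutP x : cst_ x -> outs S1 (cout x).
Proof. by move=> [hx _ _]; exact: outP. Qed.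

Definition par_compose : system (TX1 * TX2) (TU1 * TU2) Y :=
  System cst0_sub ctransP coutP.
End Composition.

(* A signal on [0, tau] is represented by its extension by 0 to R. *)
Definition restr (R : realType) (m : nat) (tau : R) (w : R -> 'rV[R]_m) :
    R -> 'rV[R]_m :=
  patch (fun=> 0) `[0, tau] w.

Definition const_input (R : realType) (m : nat) (tau : R) (v : 'rV[R]_m) :
    R -> 'rV[R]_m :=
  restr tau (fun=> v).

Definition inputs_on (R : realType) (n m : nat) (S : control_system R n m)
    (tau : R) : set (R -> 'rV[R]_m) :=
  [set w | exists u, [/\ cs_inputs S u, `[0, tau] `<=` sdom u &
                        w = restr tau (sigval u)]].

Definition trajectory_on (R : realType) (n m : nat)
    (S : control_system R n m) (tau : R) (w : R -> 'rV[R]_m)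
    (xi : R -> 'rV[R]_n) : Prop :=
  exists u a b, [/\ trajectory S u a b xi, (tau%:E < b)%E &
                    w = restr tau (sigval u)].

Lemma trajectory_on_input (R : realType) (n m : nat)
    (S : control_system R n m) (tau : R) (w : R -> 'rV[R]_m)
    (xi : R -> 'rV[R]_n) :
  trajectory_on S tau w xi -> inputs_on S tau w.
Proof.
move=> [u [a [b [[hu [a0 b0 hab] _ _] tb ->]]]]; exists u; split=> // t /=.
rewrite in_itv /= => /andP[t0 tt]; apply: hab; split.
  by apply: lt_le_trans a0 _; rewrite lee_fin.
by apply: le_lt_trans tb; rewrite lee_fin.
Qed.

Section TimeDiscretization.
Variables (R : realType) (n m : nat) (S : control_system R n m) (tau : R).

Let dtrans (x : 'rV[R]_n) (w : R -> 'rV[R]_m) (y : 'rV[R]_n) : Prop :=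
  [/\ cs_X S x, cs_X S y &
      exists xi, [/\ trajectory_on S tau w xi, xi 0 = x, xi tau = y &
                     forall t : R, 0 <= t <= tau -> cs_X S (xi t)]].

Let dtransP x w y : dtrans x w y ->
  [/\ cs_X S x, inputs_on S tau w & cs_X S y].
Proof. by move=> [hx hy [xi [/trajectory_on_input hw _ _ _]]]. Qed.

Let doutP (x : 'rV[R]_n) : cs_X S x -> cs_X S (id x). Proof. by []. Qed.

Definition time_disc : system 'rV[R]_n (R -> 'rV[R]_m) 'rV[R]_n :=
  System (@cs_X0_sub _ _ _ S) dtransP doutP.
End TimeDiscretization.

Definition lattice (R : realType) (n : nat) (A : set 'rV[R]_n) (mu : R) :
    set 'rV[R]_n :=
  [set a | A a /\ forall i, exists k : int, a ord0 i = k%:~R * mu].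

Definition halfopen_ball (R : realType) (n : nat) (eta : R) (y : 'rV[R]_n) :
    set 'rV[R]_n :=
  [set z | forall i, y ord0 i - eta <= z ord0 i < y ord0 i + eta].

Section SymbolicSystem.
Variables (R : realType) (n m : nat) (S : control_system R n m).
Variables (tau eta mu : R).

Let sst := lattice (cs_X S) (2 * eta).
Let sst0 := sst `&` cs_X0 S.
Let sinp := lattice (cs_U S) (2 * mu).
Let strans (x : 'rV[R]_n) (v : 'rV[R]_m) (y : 'rV[R]_n) : Prop :=
  [/\ sst x, sinp v, sst y &
      exists xi, [/\ trajectory_on S tau (const_input tau v) xi, xi 0 = x &
                     (halfopen_ball eta y `&` cs_X S) (xi tau)]].

Let sst0_sub : sst0 `<=` sst. Proof. by move=> x []. Qed.
Let stransP x v y : strans x v y -> [/\ sst x, sinp v & sst y].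
Proof. by move=> []. Qed.
Let soutP x : sst x -> cs_X S (id x). Proof. by move=> []. Qed.

Definition symbolic : system 'rV[R]_n 'rV[R]_m 'rV[R]_n :=
  System sst0_sub stransP soutP.
End SymbolicSystem.

Definition symbolic_controller (R : realType) (n m : nat)
    (S : control_system R n m) (tau theta mu : R)
    (C : system 'rV[R]_n (R -> 'rV[R]_m) 'rV[R]_n) : Prop :=
  [/\ st C = lattice (cs_X S) (2 * theta),
      inp C = [set w | inputs_on S tau w /\
                 forall t : R, 0 <= t <= tau -> lattice (cs_U S) (2 * mu) (w t)],
      outs C = st C &
      forall x, st C x -> out C x = x].

(* N, whose states are pairs (x, x) and whose inputs are pairs (v, 0), is the
   same system as C once (x, x) is read as x and (v, 0) as the constant input
   v on [0, tau]; the states of C that do not come from N are neither initial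
   nor attached to any transition. *)
Definition identified_with (R : realType) (n m k : nat) (tau : R)
    (N : system ('rV[R]_n * 'rV[R]_n) ('rV[R]_m * 'rV[R]_k) 'rV[R]_n)
    (C : system 'rV[R]_n (R -> 'rV[R]_m) 'rV[R]_n) : Prop :=
  [/\ forall p, st N p -> exists x, [/\ p = (x, x), st C x & out N p = out C x],
      forall x, st0 C x <-> st0 N (x, x),
      forall p u q, trans N p u q -> exists x v y,
        [/\ p = (x, x), u = (v, 0), q = (y, y) &
            trans C x (const_input tau v) y] &
      forall x w y, trans C x w y -> exists2 v,
        w = const_input tau v & trans N (x, x) (v, 0) (y, y)].

(* Main.v *)
Require Import Defs.
From mathcomp Require Import all_boot all_order all_algebra.
From mathcomp Require Import all_classical all_reals all_analysis.
From mathcomp Require Import ess_sup_inf lra.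

Set Implicit Arguments.
Unset Strict Implicit.
Unset Printing Implicit Defensive.

Import Order.TTheory GRing.Theory Num.Theory.
Local Open Scope ring_scope.

(** Incremental stability turns each symbolic transition into one that can be
    followed from nearby.  Suppose [p -v-> p'] in the symbolic model of a
    system and [x] lies within [theta] of [p].  Apply from [x] the very input
    that drives [p]: the inputs being equal, the estimate of delta-ISS reduces
    to its decay term, so after time [tau] the two trajectories are within
    [beta theta tau], and [p'] is within [eta] of the one starting at [p].
    As [beta theta tau + eta <= theta], the point reached from [x] is again
    within [theta] of [p'].  This is [symbolic_step_tracking].

    The three claims follow.  A state of the controller is a pair of equal
    lattice points, [q] say, since its two components are composed with
    precision 0.  Tracking in the plant, with [theta_p], shows that the closed
    loop can answer each move of the non-blocking controller, hence does not
    block.  Tracking in the specification, with [theta_q], shows that being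
    [theta_q]-close to [q] is preserved by the steps of the controller, which
    gives the simulation relation; the outputs then differ by at most
    [theta_p + theta_q <= eps] by the triangle inequality through [q].  The
    controller is put in the required form by reading the pair of equal points
    as one point, and its input, a lattice value of the plant paired with the
    only value 0 of the specification, as a constant signal. *)

(** The Lebesgue measure of the line being positive, the essential supremum of
    the zero function is 0. *)
Lemma input_dist_eq0 (R : realType) (m : nat) (u v : signal R m) :
  (forall t, sdom u t -> sdom v t -> sigval u t = sigval v t) ->
  input_dist u v = 0%:E.
Proof.
move=> uv; rewrite /input_dist (_ : _ \o _ = cst 0%:E).
  apply: ess_sup_cst.
  have := @lebesgue_measure_itv R `]-oo, +oo[.
  by rewrite set_itvNyy /= => muT; rewrite [ltRHS]muT addye ?ltry.
apply/funext => t /=; rewrite /patch; case: ifPn => // /set_mem[ut vt].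
by rewrite uv// subrr normr0.
Qed.

Lemma halfopen_ball_dist (R : realType) (n : nat) (eta : R) (y z : 'rV[R]_n) :
  0 <= eta -> halfopen_ball eta y z -> `|z - y| <= eta.
Proof.
move=> eta0 yz; rewrite /Num.Def.normr/=.
have [->//|/mx_norm_neq0[[i j] ->]/=] := eqVneq (mx_norm (z - y)) 0.
rewrite !mxE (ord1 i) ler_norml; have /andP[] := yz j; lra.
Qed.

Lemma class_KL_le (R : realType) (beta : R -> R -> R) (r r' s : R) :
  class_KL beta -> 0 <= r -> r <= r' -> 0 <= s -> beta r s <= beta r' s.
Proof.
move=> [_ betaK _] r0 rr' s0; have [_ mono _ _] := betaK s s0.
by have [->//|neq] := eqVneq r r'; rewrite ltW// mono// lt_neqAle neq.
Qed.

(** Forward completeness may have to prolong the input itself, whence a signal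
    [v] other than [u]; it agrees with [u] wherever both are defined, so that
    its distance to [u] vanishes. *)
Lemma trajectory_from (R : realType) (n m : nat) (S : control_system R n m)
    (x : 'rV[R]_n) (u : signal R m) :
  forward_complete S -> has_trajectories S -> cs_inputs S u ->
  exists v a xi, [/\ trajectory S v a +oo%E xi, xi 0 = x &
    forall t, sdom u t -> sdom v t /\ sigval v t = sigval u t].
Proof.
move=> fwd ex Su; have [a [b [xi [Sxi xi0]]]] := ex x u Su.
have [v [xi' [Sxi' uv xixi']]] := fwd _ _ _ _ Sxi.
exists v, a, xi'; split=> //; rewrite xixi'//.
by have [_ [a0 b0 _] _ _] := Sxi.
Qed.

(** A closeness of [theta] is preserved when a symbolic transition is answered
    with the same input, since the decay in time [tau] compensates for the
    quantization of the target. *)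
Lemma symbolic_step_tracking (R : realType) (n m : nat)
    (S : control_system R n m) (beta : R -> R -> R) (gamma : R -> R)
    (theta tau eta mu : R) (p x p' : 'rV[R]_n) (v : 'rV[R]_m) :
  forward_complete S -> has_trajectories S -> state_space_invariant S ->
  class_KL beta -> delta_ISS_estimate S beta gamma -> gamma 0 = 0 ->
  0 <= tau -> 0 <= eta -> beta theta tau + eta <= theta ->
  trans (symbolic S tau eta mu) p v p' -> cs_X S x -> `|x - p| <= theta ->
  exists2 x', trans (time_disc S tau) x (const_input tau v) x' &
              `|x' - p'| <= theta.
Proof.
move=> fwd ex inv betaKL est gamma0 tau0 eta0 contr.
move=> [_ _ _ [xi [[u [a [b [Sxi taub uE]]]] xi0 [xitau _]]]] Xx xp.
have [Su [a0 b0 abu] _ _] := Sxi.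
have [w [a' [ze [Sze ze0 uw]]]] := trajectory_from x fwd ex Su.
have Xze t : 0 <= t -> cs_X S (ze t).
  by move=> t0; apply: (inv _ _ _ _ Sze) => //; rewrite ?ze0// ltry.
exists (ze tau).
- split; [by []|exact: Xze|exists ze; split=> //; last by move=> t /andP[/Xze]].
  exists w, a', +oo%E; split=> //; first exact: ltry.
  rewrite uE; apply/funext => t; rewrite /restr /patch; case: ifPn => //.
  move=> /set_mem; rewrite /= in_itv/= => /andP[t0 ttau].
  have /uw[] // : sdom u t.
  apply: abu; split; first by rewrite (lt_le_trans a0)// lee_fin.
  by rewrite (le_lt_trans _ taub)// lee_fin.
- have wu : input_dist w u = 0%:E.
    by apply: input_dist_eq0 => t _ /uw[].
  have := est _ _ _ _ _ _ _ _ _ _ Sze Sxi wu tau0 (ltry _) taub.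
  rewrite ze0 xi0 gamma0 addr0 => zexi.
  have xip := halfopen_ball_dist eta0 xitau.
  have := class_KL_le betaKL (normr_ge0 (x - p)) xp tau0.
  have := ler_distD (xi tau) (ze tau) p'.
  lra.
Qed.

Lemma par_compose0_st (R : realType) (Y : normedModType R)
    (TX1 TU1 TX2 TU2 : Type) (S1 : system TX1 TU1 Y)
    (S2 : system TX2 TU2 Y) (x : TX1 * TX2) :
  st (par_compose 0 S1 S2) x -> out S1 x.1 = out S2 x.2.
Proof. by case=> _ _; rewrite normr_le0 subr_eq0 => /eqP. Qed.

(** Composition with precision 0 leaves only pairs of equal points as states,
    and an input of the second model is 0, so nothing is lost by keeping one
    copy of the point and the first input, read as a constant signal.  The
    lattice points that this misses become isolated states. *)
Lemma diagonal_controller (R : realType) (n m k : nat)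
    (P : control_system R n m) (Q : control_system R n k) (tau eta mu : R)
    (N : system ('rV[R]_n * 'rV[R]_n) ('rV[R]_m * 'rV[R]_k) 'rV[R]_n) :
  cs_U Q = [set 0]%classic ->
  sub_system N (par_compose 0 (symbolic P tau eta mu) (symbolic Q tau eta 0)) ->
  exists2 C, symbolic_controller P tau eta mu C & identified_with tau N C.
Proof.
move=> UQ [subst sub0 _ subtrans [_ subout]].
pose X := lattice (cs_X P) (2 * eta).
pose X0 : set 'rV[R]_n := [set x | st0 N (x, x)]%classic.
pose W : set (R -> 'rV[R]_m) := [set w | inputs_on P tau w /\
  forall t : R, 0 <= t <= tau -> lattice (cs_U P) (2 * mu) (w t)]%classic.
pose T x w y := exists2 v,
  w = const_input tau v & trans N (x, x) (v, 0) (y, y).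
have X0X : (X0 `<=` X)%classic by move=> x /sub0[_ []].
have TP x w y : T x w y -> [/\ X x, W w & X y].
  move=> [v -> /subtrans[_ _ [Xx Uv Xy [xi [traj _ _]]] _]]; split => //.
  split; first exact: trajectory_on_input traj.
  move=> t t0tau; rewrite /const_input /restr /patch ifT//.
  by rewrite inE /= in_itv.
exists (@System _ _ _ X X0 W T X id X0X TP (fun x Xx => Xx)); first by split.
have diag p : st N p -> exists2 x, p = (x, x) & X x.
  case: p => x y /subst xy; exists x; last by case: xy.
  by congr pair; have /= := par_compose0_st xy.
split=> //=.
- move=> p Np; have [x px Xx] := diag p Np.
  by exists x; split=> //; rewrite subout// px.
- move=> p u q puq; have [Np _ Nq] := transP puq.
  have [x px _] := diag p Np; have [y qy _] := diag q Nq.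
  case: u puq => v z puq; have [_ _ _ [_ /= [+ _] _ _]] := subtrans _ _ _ puq.
  rewrite UQ => z0; rewrite z0 in puq.
  exists x, v, y; split; rewrite ?z0//.
  by exists v => //; rewrite -px -qy.
Qed.

Theorem theorem4p8 (R : realType) (n m : nat)
  (P : control_system R n m) (Q : control_system R n n)
  (beta_p beta_q : R -> R -> R) (gamma_p : R -> R)
  (eps theta_p theta_q tau eta mu : R)
  (hQ : autonomous Q)
  (hXP : state_space_invariant P)
  (hXQ : state_space_invariant Q)
  (hISSP : delta_ISS_with P beta_p gamma_p)
  (hISSQ : delta_ISS_autonomous_with Q beta_q)
  (heps : 0 < eps) (hthp : 0 < theta_p) (hthq : 0 < theta_q)
  (hth : theta_p + theta_q <= eps)
  (htau : 0 < tau) (heta : 0 < eta) (hmu : 0 < mu)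
  (hp : beta_p theta_p tau + gamma_p mu + eta <= theta_p)
  (hq : beta_q theta_q tau + eta <= theta_q) :
  let Cstar := par_compose 0 (symbolic P tau eta mu) (symbolic Q tau eta 0) in
  let closed_loop := par_compose theta_p (time_disc P tau) (Nb Cstar) in
  (exists2 C, symbolic_controller P tau eta mu C &
              identified_with tau (Nb Cstar) C) /\
  approx_simulated eps closed_loop (time_disc Q tau) /\
  nonblocking closed_loop.
Proof.
move=> Cstar closed_loop.
have [subN nbN _] := NbP Cstar.
have [subst sub0 _ subtrans [_ subout]] := subN.
have [fwdP exP betaP [_ gmono g0 _] estP] := hISSP.
have [fwdQ exQ betaQ estQ] := hISSQ.
have tau0 := ltW htau; have eta0 := ltW heta.
have contrP : beta_p theta_p tau + eta <= theta_p.
  by have := gmono 0 mu (lexx _) hmu; rewrite g0; lra.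
have outN pq : st (Nb Cstar) pq -> out (Nb Cstar) pq = pq.2.
  move=> Npq; rewrite subout//.
  exact: (par_compose0_st (subst _ Npq)).
have out1N pq : st (Nb Cstar) pq -> out (Nb Cstar) pq = pq.1.
  by move=> Npq; rewrite subout.
split; [|split].
- apply: diagonal_controller subN => //.
  by have [g []] := hQ.
- (* only the controller state constrains the specification state: the plant
     enters through its own distance to the controller *)
  exists (fun s z => [/\ st closed_loop s, cs_X Q z &
                         `|z - s.2.2| <= theta_q]); split.
  + by move=> s z [].
  + move=> s s0; have [[]] := s0 => Xs Ns close _ N0.
    have [_ _ Qs] := sub0 _ N0; have [[Xq _] Qq] := Qs.
    exists s.2.2 => //; split=> //.
    by rewrite subrr normr0 ltW.
  + move=> s z [[Xs Ns]]; rewrite outN//= => close _ zq.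
    have := ler_distD s.2.2 s.1 z; rewrite (distrC s.2.2 z); lra.
  + move=> s z [_ Xz zq] u s' step.
    have [_ cls' _ /subtrans[_ _ _ stepQ]] := step.
    have [z' zz' z'q] := symbolic_step_tracking
      fwdQ exQ hXQ betaQ estQ erefl tau0 eta0 hq stepQ Xz zq.
    exists (const_input tau u.2.2), z'; split=> //; split=> //.
    by case: zz'.
- move=> [x pq] cls; have [Xx Npq] := cls; rewrite out1N//= => xp.
  have [[v w] [pq' step]] := nbN pq Npq.
  have [_ _ stepP _] := subtrans _ _ _ step.
  have [x' xx' x'p] := symbolic_step_tracking
    fwdP exP hXP betaP estP g0 tau0 eta0 contrP stepP Xx xp.
  exists (const_input tau v, (v, w)), (x', pq'); split=> //.
  have [_ Xx' _] := xx'; have [_ _ Npq'] := transP step.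
  by split=> //=; rewrite out1N.
Qed.
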